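(* Let $\mathbb F$ be an algebraically closed field of characteristic different from $2$. Let $\mathbb A$ be a finite-dimensional non-degenerate evolution algebra over $\mathbb F$ with $\delta(\mathbb A)=(n_1,\dots,n_r)$ and $\Delta(\mathbb A)=(\overline{\mathbb A_1},\dots,\overline{\mathbb A_r})$, and let $\mathbf B$ be an adapted natural basis of $\mathbb A$. Let $\mathfrak D$ be a derivation of $\mathbb A$ and, for $1\le k\le r$, let $D_k$ be the $k$-th diagonal block (of size $n_k\times n_k$) of the matrix of $\mathfrak D$ in the basis $\mathbf B$. Then for every $1\le k\le r$, the linear map corresponding to the matrix $D_k$ is a derivation of $\overline{\mathbb A_k}$.
   Context: Algebras are finite-dimensional over $\mathbb F$ with a bilinear product, not necessarily associative; a derivation is a linear map $\mathfrak D$ with $\mathfrak D(xy)=\mathfrak D(x)y+x\mathfrak D(y)$, and its matrix $(d_{ij})$ in a basis is given by $\mathfrak D(e_j)=\sum_i d_{ij}e_i$. An evolution algebra is an algebra having a basis $\mathbf B=\{e_1,\dots,e_n\}$ (a natural basis) with $e_ie_j=0$ for $i\ne j$; its structure matrix relative to $\mathbf B$ is $(w_{ki})$ where $e_i^2=\sum_k w_{ki}e_k$. It is non-degenerate if $\mathrm{Ann}(\mathbb A)=\{x: x\mathbb A+\mathbb Ax=0\}$ is zero. An extending evolution subspace is a linear subspace spanned by a subset of some natural basis of $\mathbb A$. For subspaces $X,Y$, $XY$ denotes the linear span of all products, and $X^2=XX$. Every non-degenerate evolution algebra has a unique (up to order) decomposition $\mathbb A=\mathbb E_1\oplus\dots\oplus\mathbb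 E_r$, where the $\mathbb E_i$ are extending evolution subspaces with $\dim(\mathbb E_i^2)=1$, and $\mathbb E_i\mathbb E_j=0$, $\dim(\mathbb E_i^2+\mathbb E_j^2)=2$ for $i\neq j$. The $\delta$-index is $\delta(\mathbb A)=(\dim\mathbb E_1,\dots,\dim\mathbb E_r)$, in non-increasing order. Let $\mathbb A_i$ be the algebra on $\mathbb E_i$ with product $x\cdot y=\pi_{\mathbb E_i}(xy)$, where $\pi_{\mathbb E_i}$ is the projection of $\mathbb A$ onto $\mathbb E_i$ along the other summands. With $m=\dim\mathbb E_i$, it is isomorphic to exactly one algebra $\overline{\mathbb A_i}$ among the following (basis $e_1,\dots,e_m$, $e_ie_j=0$ for $i\ne j$): $\mathbf O_m$ (zero product); $\mathbf E_m$: $e_1^2=\dots=e_m^2=e_1$; or, for $m\ge2$, $\mathbf I_m$: $e_1^2=\dots=e_m^2=e_1+\mathbf ie_2$, where $\mathbf i^2=-1$. The $\Delta$-trace is $\Delta(\mathbb A)=(\overline{\mathbb A_1},\dots,\overline{\mathbb A_r})$, ordered by non-increasing dimension and, in equal dimension, with $\mathbf O$ first, then $\mathbf E$, then $\mathbf I$. Adapted natural basis: a natural basis $\mathbf B=\mathbf B_1\cup\dots\cup\mathbf B_r$ (ordered block by block), with $\mathbf B_i$ a basis of $\mathbb E_i$, such that the structure matrix of $\mathbb A$ relative to $\mathbf B$ has as $i$-th diagonal block the structure matrix of $\overline{\mathbb A_i}$ in its defining basis, and within each block $i$ of columns all columns are equal (i.e. $e^2=f^2$ for all $e,f\in\mathbf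 B_i$). Such a basis always exists. *)

(* Defs.v *)
From HB Require Import structures.
From mathcomp Require Import all_boot all_order all_algebra.

Set Implicit Arguments.
Unset Strict Implicit.
Unset Printing Implicit Defensive.

Import GRing.Theory.
Local Open Scope ring_scope.

(* A (not necessarily associative) finite-dimensional algebra is a vectType    *)
(* together with a bilinear product mul. The predicates that only read the     *)
(* product take mul as a plain function.                                       *)

Section Algebras.

Variables (F : fieldType) (A : vectType F) (mul : A -> A -> A).

Definition derivation (D : 'End(A)) : Prop :=
  forall x y, D (mul x y) = mul (D x) y + mul x (D y).

(* Like prodv for falgType, the product of subspaces is generated by the       *)
(* products of basis vectors; vmulP shows that, mul being bilinear, this is    *)
(* the span of all the products.                                               *)
Definition vmul (X Y : {vspace A}) : {vspace A} :=
  <<[seq mul u v | u <- vbasis X, v <- vbasis Y]>>%VS.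

Definition nondegenerate_algebra : Prop :=
  forall x, (forall y, mul x y = 0 /\ mul y x = 0) -> x = 0.

Definition natural_basis n (B : n.-tuple A) : Prop :=
  basis_of fullv B /\
  forall i j : 'I_n, i != j -> mul (tnth B i) (tnth B j) = 0.

Definition evolution_algebra : Prop :=
  exists n (B : n.-tuple A), natural_basis B.

Definition structure_mx n (B : n.-tuple A) : 'M[F]_n :=
  \matrix_(k, i) coord B k (mul (tnth B i) (tnth B i)).

Definition extending_subspace (X : {vspace A}) : Prop :=
  exists n (B : n.-tuple A), natural_basis B /\
    exists2 s : seq A, {subset s <= B} & X = <<s>>%VS.

End Algebras.

Lemma vmulP (F : fieldType) (A : vectType F) (mul : {bilinear A -> A -> A})
    (X Y Z : {vspace A}) :
  reflect {in X & Y, forall u v, mul u v \in Z} (vmul mul X Y <= Z)%VS.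
Proof.
apply: (iffP idP) => [sXYZ u v Xu Yv | sXYZ].
  rewrite (coord_vbasis Xu) (coord_vbasis Yv) linear_sumlz; apply: memv_suml.
  move=> i _; rewrite linear_sumr; apply: memv_suml => j _.
  rewrite linearZl_LR linearZr_LR /=; apply/memvZ/memvZ/(subvP sXYZ)/memv_span.
  by apply/allpairsP; exists ((vbasis X)`_i, (vbasis Y)`_j);
    rewrite !mem_nth ?size_tuple.
apply/span_subvP => _ /allpairsP[[u v] /= [Xu Yv ->]].
by rewrite sXYZ ?vbasis_mem.
Qed.

(* Acts on columns, unlike mxof: D e_j = \sum_i d_ij e_i.                      *)
Definition endo_mx (F : fieldType) (A : vectType F) n (B : n.-tuple A)
    (D : 'End(A)) : 'M[F]_n :=
  \matrix_(i, j) coord B i (D (tnth B j)).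

Definition alg_isom (F : fieldType) (U V : vectType F)
    (mulU : U -> U -> U) (mulV : V -> V -> V) : Prop :=
  exists2 f : {linear U -> V},
    bijective f & forall x y, f (mulU x y) = mulV (f x) (f y).

Section Decomposition.

Variables (F : fieldType) (A : vectType F) (mul : A -> A -> A) (r : nat).
Variable E : 'I_r -> {vspace A}.

Definition evolution_decomposition : Prop :=
  [/\ (\sum_i E i)%VS = fullv,
      directv (\sum_i E i),
      forall i, extending_subspace mul (E i),
      forall i, \dim (vmul mul (E i) (E i)) = 1%N &
      forall i j, i != j ->
        vmul mul (E i) (E j) = 0%VS /\
        \dim (vmul mul (E i) (E i) + vmul mul (E j) (E j)) = 2%N].

Definition delta_index (n : 'I_r -> nat) : Prop :=
  (forall i, n i = \dim (E i)) /\
  (forall i j : 'I_r, (i <= j)%N -> (n j <= n i)%N).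

Definition block_proj (i : 'I_r) : 'End(A) :=
  daddv_pi (E i) (\sum_(j | j != i) E j).

Definition block_mul (i : 'I_r) (x y : subvs_of (E i)) : subvs_of (E i) :=
  vsproj (E i) (block_proj i (mul (vsval x) (vsval y))).

End Decomposition.

(* The evolution algebra on column vectors whose structure matrix relative to  *)
(* the canonical basis is W; see evo_mul_delta.                                *)
Definition evo_mul (F : fieldType) m (W : 'M[F]_m) (x y : 'cV[F]_m) : 'cV[F]_m :=
  \col_k \sum_i W k i * (x i 0 * y i 0).

Lemma evo_mul_delta (F : fieldType) m (W : 'M[F]_m) (i j : 'I_m) :
  evo_mul W (delta_mx i 0) (delta_mx j 0) = if i == j then col i W else 0.
Proof.
apply/matrixP => k l; rewrite !mxE (bigD1 i) //= big1 => [|p /negPf np].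
  by rewrite !mxE !eqxx /= addr0 mul1r; case: eqP => _; rewrite !mxE
    ?mulr1 ?mulr0.
by rewrite !mxE np mul0r mulr0.
Qed.

Variant model := ModelO | ModelE | ModelI.

(* I_m only makes sense for m >= 2, whence the guard in Delta_trace.           *)
Definition model_mx (F : fieldType) (im : F) (m : nat) (t : model) : 'M[F]_m :=
  \matrix_(k, i)
    match t with
    | ModelO => 0
    | ModelE => (k == 0 :> nat)%:R
    | ModelI => (k == 0 :> nat)%:R + im * (k == 1 :> nat)%:R
    end.

Definition model_mul (F : fieldType) (im : F) (m : nat) (t : model) :
    'cV[F]_m -> 'cV[F]_m -> 'cV[F]_m :=
  evo_mul (model_mx im m t).

Definition model_rank (t : model) : nat :=
  match t with ModelO => 0 | ModelE => 1 | ModelI => 2 end.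

(* Entry i of the Delta-trace is the model of type t i in dimension n i.       *)
Definition Delta_trace (F : fieldType) (im : F) (A : vectType F)
    (mul : A -> A -> A) r (E : 'I_r -> {vspace A})
    (n : 'I_r -> nat) (t : 'I_r -> model) : Prop :=
  [/\ forall i, t i = ModelI -> (2 <= n i)%N,
      forall i, alg_isom (@block_mul F A mul r E i) (@model_mul F im (n i) (t i)) &
      forall i j : 'I_r, (i <= j)%N ->
        (n j < n i)%N \/ n i = n j /\ (model_rank (t i) <= model_rank (t j))%N].

(* tagnat.Rank i j is the position of the j-th vector of the i-th block.       *)
Definition adapted_basis (F : fieldType) (im : F) (A : vectType F)
    (mul : A -> A -> A) r (E : 'I_r -> {vspace A})
    (n : 'I_r -> nat) (t : 'I_r -> model) (B : (\sum_i n i).-tuple A) : Prop :=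
  [/\ natural_basis mul B,
      forall i, basis_of (E i)
        [seq tnth B (tagnat.Rank i j) | j <- enum 'I_(n i)],
      forall i, submxblock (structure_mx mul B) i i = model_mx im (n i) (t i) &
      forall i (j l : 'I_(n i)),
        let e := tnth B (tagnat.Rank i j) in
        let f := tnth B (tagnat.Rank i l) in mul e e = mul f f].

(* Main.v *)
Require Import Defs.
From HB Require Import structures.
From mathcomp Require Import all_boot all_order all_algebra.

Set Implicit Arguments.
Unset Strict Implicit.
Unset Printing Implicit Defensive.

Import GRing.Theory.
Local Open Scope ring_scope.

(* Let v_k be the common square of the vectors of the k-th block. Applying a
   derivation D = (d_ij) to e_i e_j = 0, with e_i^2 and e_j^2 linearly
   independent when e_i and e_j lie in distinct blocks, shows that D is block
   diagonal. As v_k != 0, comparing D (e_i e_j) for e_i, e_j in the k-th block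
   with D v_k = c v_k gives D_k + D_k^T = c I. Projecting D v_k = c v_k onto the
   block yields D_k w = c w, with w the common column of the model. The product
   of the model is x . y = (x^T y) w, and D_k multiplies both the form x^T y and
   the vector w by c. *)

(** By bilinearity any spanning family can replace the [vbasis] in the definition of [vmul]; here it
    will be a block of the adapted basis. *)
Lemma vmul_span_sub (F : fieldType) (A : vectType F)
    (mul : {bilinear A -> A -> A}) (X : seq A) (Z : {vspace A}) :
  {in X &, forall u v, mul u v \in Z} -> (vmul mul <<X>> <<X>> <= Z)%VS.
Proof.
move=> sXZ; apply/vmulP => u v.
rewrite -[X]/(val (in_tuple X)) => /coord_span-> /coord_span->.
rewrite linear_sumlz; apply: memv_suml => i _.
rewrite linear_sumr; apply: memv_suml => j _.
rewrite linearZl_LR linearZr_LR /=.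
by do 2!apply: memvZ; rewrite sXZ ?mem_nth.
Qed.

Lemma dimv_add_vline_eq0 (F : fieldType) (A : vectType F) (u v : A) (a b : F) :
  (2 <= \dim (<[u]> + <[v]>))%N -> a *: u + b *: v = 0 -> a = 0 /\ b = 0.
Proof.
move=> dim2 eq0; have: free [:: u; v].
  by rewrite /free eqn_leq dim_span /= span_cons span_seq1.
move=> /(freeP (X := [tuple u; v]))/(_ (fun i : 'I_2 => [:: a; b]`_i)).
rewrite !big_ord_recl big_ord0 addr0 => /(_ eq0) h.
by split; [apply: (h 0) | apply: (h 1)].
Qed.

(** Every canonical basis vector squares to [w], so the product is the standard bilinear form times
    [w]. *)
Lemma evo_mul_eq_cols (F : fieldType) m (w x y : 'cV[F]_m) :
  evo_mul (\matrix_(k, i) w k 0) x y = (x^T *m y) 0 0 *: w.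
Proof.
apply/colP => k; rewrite !mxE mulr_suml; apply: eq_bigr => i _.
by rewrite !mxE mulrC.
Qed.

Lemma derivation_evo_mul_eq_cols (F : fieldType) m (M : 'M[F]_m) (w : 'cV[F]_m)
    (c : F) :
  M + M^T = c%:M -> M *m w = c *: w ->
  derivation (evo_mul (\matrix_(k, i) w k 0)) (linfun (mulmx M)).
Proof.
move=> symM Mw x y; rewrite !lfunE /= !evo_mul_eq_cols -scalemxAr Mw scalerA.
rewrite -scalerDl; congr (_ *: _).
transitivity (((M *m x)^T *m y + x^T *m (M *m y)) 0 0); last by rewrite mxE.
rewrite trmx_mul -mulmxA -mulmxDr -mulmxDl [M^T + M]addrC symM mul_scalar_mx.
by rewrite -scalemxAr [RHS]mxE mulrC.
Qed.

Lemma mul_natural_basisr (F : fieldType) (A : vectType F)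
    (mul : {bilinear A -> A -> A}) n (B : n.-tuple A) (x : A) (j : 'I_n) :
  natural_basis mul B ->
  mul x (tnth B j) = coord B j x *: mul (tnth B j) (tnth B j).
Proof.
case=> basisB orthB; rewrite {1}(coord_basis basisB (memvf x)) linear_sumlz.
rewrite (bigD1 j) //= big1 ?addr0 => [|i nij]; rewrite linearZl_LR -tnth_nth //.
by rewrite orthB // scaler0.
Qed.

Lemma mul_natural_basisl (F : fieldType) (A : vectType F)
    (mul : {bilinear A -> A -> A}) n (B : n.-tuple A) (x : A) (j : 'I_n) :
  natural_basis mul B ->
  mul (tnth B j) x = coord B j x *: mul (tnth B j) (tnth B j).
Proof.
case=> basisB orthB; rewrite {1}(coord_basis basisB (memvf x)) linear_sumr.
rewrite (bigD1 j) //= big1 ?addr0 => [|i nij]; rewrite linearZr_LR -tnth_nth //.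
by rewrite orthB 1?eq_sym // scaler0.
Qed.

(** Multiplying by [e_j] keeps only the [e_j]-coordinate of [D e_i], and symmetrically for [D e_j];
    hence the crossed indices. *)
Lemma derivation_natural_basis (F : fieldType) (A : vectType F)
    (mul : {bilinear A -> A -> A}) n (B : n.-tuple A) (D : 'End(A))
    (i j : 'I_n) :
  natural_basis mul B -> derivation mul D ->
  D (mul (tnth B i) (tnth B j)) =
    endo_mx B D j i *: mul (tnth B j) (tnth B j)
    + endo_mx B D i j *: mul (tnth B i) (tnth B i).
Proof.
move=> natB ->; rewrite !mxE (mul_natural_basisr (D _) _ natB).
by rewrite (mul_natural_basisl (D _) _ natB).
Qed.

Lemma coord_endo_mx (F : fieldType) (A : vectType F) n (B : n.-tuple A)
    (D : 'End(A)) (x : A) (i : 'I_n) :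
  basis_of fullv B -> coord B i (D x) = \sum_j endo_mx B D i j * coord B j x.
Proof.
move=> basisB; rewrite {1}(coord_basis basisB (memvf x)) !linear_sum /=.
by apply: eq_bigr => j _; rewrite !linearZ /= mxE mulrC -tnth_nth.
Qed.

Lemma sum_Rank (V : nmodType) r (n : 'I_r -> nat) (f : 'I_(\sum_i n i) -> V) :
  \sum_s f s = \sum_i \sum_j f (tagnat.Rank i j).
Proof.
rewrite sig_big_dep (reindex _ tagnat.sig_bij_on) /=.
by apply: eq_bigr => s _; rewrite tagnat.sig2K.
Qed.

Theorem theorem31 (F : closedFieldType) (char_F : 2%N \notin [pchar F])
    (im : F) (im2 : im ^+ 2 = -1)
    (A : vectType F) (mul : {bilinear A -> A -> A})
    (evoA : evolution_algebra mul) (ndA : nondegenerate_algebra mul)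
    (r : nat) (E : 'I_r -> {vspace A}) (decE : evolution_decomposition mul E)
    (n : 'I_r -> nat) (deltaA : delta_index E n)
    (t : 'I_r -> model) (DeltaA : Delta_trace im mul E n t)
    (B : (\sum_i n i).-tuple A) (adB : adapted_basis im mul E t B)
    (D : 'End(A)) (derD : derivation mul D) (k : 'I_r) :
  derivation (@model_mul F im (n k) (t k))
    (linfun (mulmx (submxblock (endo_mx B D) k k))).
Proof.
case: decE => _ _ _ dimE2 dimEE; case: adB => natB spanB blockB eqsqB.
pose e i j := tnth B (tagnat.Rank i j); pose v i j := mul (e i j) (e i j).
have e_orth i1 i2 (j1 : 'I_(n i1)) (j2 : 'I_(n i2)) :
    (i1 != i2) || (j1 != j2 :> nat) -> mul (e i1 j1) (e i2 j2) = 0.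
  by move=> neq; rewrite natB.2 // -val_eqE /= tagnat.eq_Rank negb_and.
have v_eq i j1 j2 : v i j1 = v i j2 by apply: eqsqB.
(* Products of vectors of one block are zero or the common square. *)
have vmulE i j0 : (vmul mul (E i) (E i) <= <[v i j0]>)%VS.
  rewrite -(span_basis (spanB i)); apply: vmul_span_sub.
  move=> _ _ /mapP[j _ ->] /mapP[l _ ->].
  have [<- | neq_jl] := eqVneq j l; first by rewrite (v_eq i j0 j) memv_line.
  by rewrite e_orth ?mem0v // neq_jl orbT.
have v_neq0 i j0 : v i j0 != 0.
  by have := dimvS (vmulE i j0); rewrite dimE2 dim_vline lt0b.
have D_e i1 i2 j1 j2 : D (mul (e i1 j1) (e i2 j2)) =
    endo_mx B D (tagnat.Rank i2 j2) (tagnat.Rank i1 j1) *: v i2 j2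
    + endo_mx B D (tagnat.Rank i1 j1) (tagnat.Rank i2 j2) *: v i1 j1.
  exact: derivation_natural_basis.
have D_offdiag i1 i2 j1 j2 : i1 != i2 ->
    endo_mx B D (tagnat.Rank i1 j1) (tagnat.Rank i2 j2) = 0.
  move=> neq_i; apply: (dimv_add_vline_eq0 (u := v i1 j1) (v := v i2 j2)
    (b := endo_mx B D (tagnat.Rank i2 j2) (tagnat.Rank i1 j1)) _ _).1.
    (* The two lines contain [E_i^2] and [E_j^2], whose sum has dimension 2. *)
    by have [_ <-] := dimEE _ _ neq_i; apply/dimvS/addvS.
  by rewrite addrC -D_e e_orth ?neq_i // linear0.
(* Besides naming a coordinate, [j0] provides a reference vector in the block, from which [c] and
   [w] are defined. *)
move=> x y; apply/colP => j0.
set M := submxblock _ k k.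
(* Applying [D] to the square of [e k j0] gives twice the diagonal entry as eigenvalue. *)
pose c := M j0 j0 + M j0 j0; pose w := \col_l model_mx im (n k) (t k) l j0.
have D_block j l : D (mul (e k j) (e k l)) = (M l j + M j l) *: v k j0.
  by rewrite D_e (v_eq k j j0) (v_eq k l j0) -scalerDl !mxE.
have scale_vI a b : a *: v k j0 = b *: v k j0 -> a = b.
  move=> /eqP; rewrite -subr_eq0 -scalerBl scaler_eq0 (negPf (v_neq0 k j0)).
  by rewrite orbF subr_eq0 => /eqP.
have modelE : model_mx im (n k) (t k) = \matrix_(l, i) w l 0.
  by apply/matrixP => l i; rewrite !mxE.
have coord_v l : coord B (tagnat.Rank k l) (v k j0) = w l 0.
  by rewrite mxE -blockB !mxE.
have symM : M + M^T = c%:M.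
  apply/matrixP => j l; rewrite mxE [M^T _ _]mxE [RHS]mxE addrC.
  apply: scale_vI; rewrite -D_block.
  case: (eqVneq j l) => [<- | neq_jl]; last first.
    by rewrite e_orth ?neq_jl ?orbT // linear0 scale0r.
  by rewrite -[mul _ _]/(v k j) (v_eq k j j0) D_block.
have Mw : M *m w = c *: w.
  apply/colP => l; rewrite [RHS]mxE -coord_v -linearZ -D_block /=.
  rewrite (coord_endo_mx _ _ _ natB.1) sum_Rank.
  (* The vector [v k j0] may have components outside block [k], but [D] sends none of them into that
     block. *)
  rewrite (bigD1 k) //= [X in _ + X]big1 ?addr0 => [|i neq_ik].
    by rewrite mxE; apply: eq_bigr => j _; rewrite -coord_v !mxE.
  by rewrite big1 // => j _; rewrite D_offdiag ?mul0r // eq_sym.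
by rewrite /model_mul modelE (derivation_evo_mul_eq_cols symM Mw).
Qed.
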